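(* Let $n\ge4$ and let $\Gamma$ be a connected simple graph on the $n-1$ vertices $\{2,\dots,n\}$. Then $\pi_\Gamma(\mathcal{M}_{0,n}^{\mathrm{rad}})=B'(\Gamma)$, where $\mathcal{M}_{0,n}^{\mathrm{rad}}$ is identified with $B'(K_{n-1})\subseteq\mathbb{R}^{|E(K_{n-1})|}/L$ via $\Psi$, and $\mathbb{R}^{|E(K_{n-1})|}/L/S$ is identified with $\mathbb{R}^{|E(\Gamma)|}/L$.
   Context: Rational $n$-marked tropical curves: metric trees with ends labeled $1,\dots,n$, bounded edges of positive length, vertices of valence $\ge3$. The root vertex $v_0$ carries end $1$. A radially aligned combinatorial type is the combinatorial type (tree with labeled ends, lengths forgotten) together with the weak ordering of vertices by distance from $v_0$; $\mathcal{M}_{0,n}^{\mathrm{rad}}$ is the cone complex of radially aligned curves, a refinement of the usual tropical moduli space $\mathcal{M}_{0,n}^{\mathrm{trop}}$. For a graph $G$ with edge set $E$, flats of its cycle matroid are edge sets $F$ such that adding any edge outside $F$ increases the rank (rank = number of non-isolated vertices minus number of components among them). $B'(G)\subseteq\mathbb{R}^{|E|}/L$, $L=\mathbb{R}(1,\dots,1)$, is the union of the cones spanned by $\rho_{F_1},\dots,\rho_{F_r}$ over chains of flats $\emptyset\subsetneq F_1\subsetneq\cdots\subsetneq F_r\subsetneq E$, where $\rho_F=-\sum_{e\in F}v_e$. The flats of $K_{n-1}$ (on vertex set $\{2,\dots,n\}$) are the cluster graphs $\coprod_j K_{I_j}$. There is a linear isomorphism $\Psi$ from the ambient space $Q_n=\mathbb{R}^{\binom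 n2}/\Phi(\mathbb{R}^n)$ of $\mathcal{M}_{0,n}^{\mathrm{rad}}$ to $\mathbb{R}^{|E(K_{n-1})|}/L$ identifying $\mathcal{M}_{0,n}^{\mathrm{rad}}$ with $B'(K_{n-1})$ as fans, sending the type of a curve with $d$ bounded edges of equal length from the root to vertices with end sets $I_1,\dots,I_d$ to the flat $\coprod_jK_{I_j}$. Let $S=\mathrm{span}\{v_e: e\in E(K_{n-1})\setminus E(\Gamma)\}$ and $\pi_\Gamma:\mathbb{R}^{|E(K_{n-1})|}/L\to\mathbb{R}^{|E(K_{n-1})|}/L/S$ the projection forgetting coordinates of edges not in $\Gamma$; the target is naturally isomorphic to $\mathbb{R}^{|E(\Gamma)|}/L$. *)

(* Defs.v *)
From HB Require Import structures.
From mathcomp Require Import boolp classical_sets reals.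
From mathcomp Require Import all_boot all_order all_algebra.

Set Implicit Arguments.
Unset Strict Implicit.
Unset Printing Implicit Defensive.

Import Order.TTheory GRing.Theory Num.Theory.
Local Open Scope quotient_scope.
Local Open Scope ring_scope.

(** * Quotient of a finite-dimensional vector space by a subspace *)

Section QuotientSpace.
Variables (K : fieldType) (V : vectType K) (U : {vspace V}).
Implicit Types (u v w : V).

Definition quotv_rel u v := u - v \in U.

Lemma quotv_rel_equiv : equiv_class_of quotv_rel.
Proof.
rewrite /quotv_rel; split=> [u|u v|v u w uv vw]; first by rewrite subrr mem0v.
  by rewrite -memvN opprB.
by rewrite -[u](subrK v) -addrA memvD.
Qed.

Canonical quotv_equiv := EquivRelPack quotv_rel_equiv.
Canonical quotv_encModRel := defaultEncModRel quotv_rel.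

Definition quotv := {eq_quot quotv_rel}.
HB.instance Definition _ := Choice.on quotv.
HB.instance Definition _ := EqQuotient.on quotv.

Lemma quotv_piE u v : (\pi_quotv u == \pi_quotv v) = (u - v \in U).
Proof. by rewrite piE. Qed.

Lemma quotv_reprB u : repr (\pi_quotv u) - u \in U.
Proof. by rewrite -quotv_piE reprK. Qed.

Lemma quotv_ind (P : quotv -> Prop) :
  (forall u, P (\pi_quotv u)) -> forall x, P x.
Proof. by move=> Pu x; rewrite -[x]reprK. Qed.

Definition quotv_zero : quotv := \pi_quotv 0.
Definition quotv_opp (x : quotv) : quotv := \pi_quotv (- repr x).
Definition quotv_add (x y : quotv) : quotv := \pi_quotv (repr x + repr y).
Definition quotv_scale (a : K) (x : quotv) : quotv := \pi_quotv (a *: repr x).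

Lemma quotv_oppE u : quotv_opp (\pi_quotv u) = \pi_quotv (- u).
Proof.
by apply/eqP; rewrite quotv_piE -opprD memvN quotv_reprB.
Qed.

Lemma quotv_addE u v : quotv_add (\pi_quotv u) (\pi_quotv v) = \pi_quotv (u + v).
Proof.
by apply/eqP; rewrite quotv_piE opprD addrACA memvD ?quotv_reprB.
Qed.

Lemma quotv_scaleE a u : quotv_scale a (\pi_quotv u) = \pi_quotv (a *: u).
Proof. by apply/eqP; rewrite quotv_piE -scalerBr memvZ ?quotv_reprB. Qed.

Fact quotv_addA : associative quotv_add.
Proof.
move=> x y z; elim/quotv_ind: x => u; elim/quotv_ind: y => v; elim/quotv_ind: z => w.
by rewrite !quotv_addE addrA.
Qed.
Fact quotv_addC : commutative quotv_add.
Proof. by move=> x y; elim/quotv_ind: x => u; elim/quotv_ind: y => v; rewrite !quotv_addE addrC. Qed.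
Fact quotv_add0 : left_id quotv_zero quotv_add.
Proof. by move=> x; elim/quotv_ind: x => u; rewrite /quotv_zero quotv_addE add0r. Qed.
Fact quotv_addN : left_inverse quotv_zero quotv_opp quotv_add.
Proof. by move=> x; elim/quotv_ind: x => u; rewrite quotv_oppE quotv_addE addNr. Qed.

HB.instance Definition _ := GRing.isZmodule.Build quotv
  quotv_addA quotv_addC quotv_add0 quotv_addN.

Let quotv_addrE u v : \pi_quotv u + \pi_quotv v = \pi_quotv (u + v).
Proof. exact: quotv_addE. Qed.

Fact quotv_scaleA a b (x : quotv) :
  quotv_scale a (quotv_scale b x) = quotv_scale (a * b) x.
Proof. by elim/quotv_ind: x => u; rewrite !quotv_scaleE scalerA. Qed.
Fact quotv_scale1 : left_id 1 quotv_scale.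
Proof. by move=> x; elim/quotv_ind: x => u; rewrite !quotv_scaleE scale1r. Qed.
Fact quotv_scaleDr : right_distributive quotv_scale +%R.
Proof.
move=> a x y; elim/quotv_ind: x => u; elim/quotv_ind: y => v.
by rewrite quotv_addrE !quotv_scaleE quotv_addrE scalerDr.
Qed.
Fact quotv_scaleDl (x : quotv) : {morph quotv_scale^~ x : a b / a + b}.
Proof.
elim/quotv_ind: x => u a b.
by rewrite !quotv_scaleE quotv_addrE scalerDl.
Qed.

HB.instance Definition _ := GRing.Zmodule_isLmodule.Build K quotv
  quotv_scaleA quotv_scale1 quotv_scaleDr quotv_scaleDl.

Definition qclass : V -> quotv := \pi_quotv.

Fact qclass_linear : linear qclass.
Proof.
move=> a u v; rewrite /qclass -[X in _ = X + _]/(quotv_scale a _).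
by rewrite quotv_scaleE quotv_addrE.
Qed.

HB.instance Definition _ := GRing.isLinear.Build K V quotv _ qclass
  qclass_linear.

Lemma qclass_eq u v : (qclass u == qclass v) = (u - v \in U).
Proof. exact: quotv_piE. Qed.

Lemma qclass_eq0 u : (qclass u == 0) = (u \in U).
Proof. by rewrite -(linear0 qclass) qclass_eq subr0. Qed.

Lemma qclass_repr (x : quotv) : qclass (repr x) = x.
Proof. exact: reprK. Qed.

Fact quotv_vect_iso : Vector.axiom (\dim (U^C)%VS) quotv.
Proof.
pose p u := vsproj (U^C)%VS (u - projv U u).
have pE u : vsval (p u) = u - projv U u by rewrite vsprojK // memv_projC.
have p_lin : linear p.
  move=> a u v; apply: subvs_inj; rewrite linearP /= !pE linearP.
  by rewrite scalerBr opprD addrACA.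
have pU u : u \in U -> p u = 0.
  by move=> uU; apply: subvs_inj; rewrite pE projv_id // subrr.
have pq u : p (repr (qclass u)) = p u.
  rewrite -[repr _](subrK u) -[X in X + _]scale1r p_lin pU ?quotv_reprB //.
  by rewrite scaler0 add0r.
have [f f_lin f_bij] := subvs_vect_iso (U^C)%VS.
exists (fun x : quotv => f (p (repr x))).
  move=> a x y; rewrite -[x]qclass_repr -[y]qclass_repr -linearP !pq.
  by rewrite p_lin f_lin.
suff p_bij : bijective (fun x : quotv => p (repr x)).
  exact: bij_comp f_bij p_bij.
exists (fun w : subvs_of (U^C)%VS => qclass (vsval w)) => [x|w].
  rewrite pE -[RHS]qclass_repr; apply/eqP; rewrite qclass_eq.
  by rewrite addrAC subrr add0r memvN memv_proj.
rewrite pq; apply: subvs_inj; rewrite pE.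
have wC : vsval w \in (U^C)%VS by exact: subvsP.
suff -> : projv U (vsval w) = 0 by rewrite subr0.
apply/eqP; rewrite -memv0 -(capv_compl U) memv_cap memv_proj /=.
by rewrite -[projv _ _](subKr (vsval w)) memvB // memv_projC.
Qed.

HB.instance Definition _ := Lmodule_hasFinDim.Build K quotv quotv_vect_iso.

(* The map induced by [f] on the quotient; it is meaningful when [f] vanishes
   on [U], see [quotv_liftE]. *)
Definition quotv_lift (T : Type) (f : V -> T) (x : quotv) : T := f (repr x).

Section Lift.
Variables (W : lmodType K) (f : {linear V -> W}).
Hypothesis fU : forall u, u \in U -> f u = 0.

Lemma quotv_liftE u : quotv_lift f (qclass u) = f u.
Proof.
by apply/eqP; rewrite -subr_eq0 -linearB fU //; exact: quotv_reprB.
Qed.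

Lemma quotv_lift_linear : linear (quotv_lift f).
Proof.
move=> a x y; rewrite -[x]qclass_repr -[y]qclass_repr -linearP.
by rewrite !quotv_liftE linearP.
Qed.

Lemma quotv_lift_inj :
  (forall u, f u = 0 -> u \in U) -> injective (quotv_lift f).
Proof.
move=> fU' x y; rewrite -[x]qclass_repr -[y]qclass_repr !quotv_liftE => /eqP.
rewrite -subr_eq0 -linearB => /eqP/fU' xyU.
by apply/eqP; rewrite qclass_eq.
Qed.

End Lift.

End QuotientSpace.

(** * Simple graphs, cycle-matroid flats and the fan B' *)

Record sgraph (T : finType) := SGraph {
  sedges :> {set {set T}};
  sedgesP : forall e, e \in sedges -> #|e| = 2
}.

Section Graphs.
Variable T : finType.
Implicit Types (G : sgraph T) (F : {set {set T}}).

Definition adj F : rel T := [rel x y | (x != y) && ([set x; y] \in F)].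

Definition graph_connected G := forall x y, connect (adj G) x y.

(* Closed walks without repeated vertices have length at most 2, that is, they
   are trivial or go back and forth along one edge. *)
Definition graph_acyclic G := forall c : seq T, ucycle (adj G) c -> (size c <= 2)%N.

Definition is_tree G := graph_connected G /\ graph_acyclic G.

Lemma complete_subproof (e : {set T}) :
  e \in [set e : {set T} | #|e| == 2] -> #|e| = 2.
Proof. by rewrite inE => /eqP. Qed.
Definition complete : sgraph T := SGraph complete_subproof.

Definition edge G := {e : {set T} | e \in sedges G}.

(* [cover F] is the set of non-isolated vertices of the graph with edge set
   [F]. *)
Definition grank F : nat := (#|cover F| - n_comp (adj F) (cover F))%N.

Definition flat G F :=
  F \subset sedges G /\
  forall e, e \in sedges G -> e \notin F -> (grank F < grank (e |: F))%N.

(* A chain [set0 < F_1 < ... < F_r < E] of flats; [r = 0] is allowed and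
   contributes the cone [{0}]. *)
Definition flag G (Fs : seq {set {set T}}) :=
  sorted (fun F F' => F \proper F') Fs /\
  forall F, F \in Fs -> [/\ flat G F, set0 \proper F & F \proper sedges G].

End Graphs.

Arguments complete : clear implicits.

Lemma inj_surj_bij (A B : Type) (f : A -> B) (g : B -> A) :
  injective f -> cancel g f -> bijective f.
Proof. by move=> fI gK; exists g => // x; apply: fI; rewrite gK. Qed.

Section Bergman.
Variables (R : realType) (T : finType) (G : sgraph T).

Definition edgespace := {ffun edge G -> R^o}.

Definition vvec (e : edge G) : edgespace := [ffun e' => (e' == e)%:R].

Definition lineality : {vspace edgespace} := <[([ffun=> 1] : edgespace)]>%VS.

Definition rho (F : {set {set T}}) : quotv lineality :=
  qclass lineality (- \sum_(e : edge G | val e \in F) vvec e).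

Definition flag_cone (Fs : seq {set {set T}}) : set (quotv lineality) :=
  [set x | exists2 c : {set {set T}} -> R, (forall F, 0 <= c F) &
     x = \sum_(F <- Fs) c F *: rho F].

Definition Bprime : set (quotv lineality) :=
  \bigcup_(Fs in flag G) flag_cone Fs.

End Bergman.

Arguments Bprime R {T} G.

(** * Forgetting the coordinates of the edges outside a graph *)

Section Forget.
Variables (R : realType) (T : finType) (G : sgraph T).
Local Notation K := (complete T).
Local Notation LK := (lineality R K).
Local Notation LG := (lineality R G).

Definition forget_space : {vspace quotv LK} :=
  <<[seq qclass LK (vvec R e) | e in [pred e : edge K | val e \notin sedges G]]>>%VS.

Definition pi_graph : quotv LK -> quotv forget_space := qclass forget_space.

Lemma edge_complete_subproof (e : edge G) : val e \in sedges K.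
Proof. by rewrite inE; apply/eqP; exact: sedgesP (valP e). Qed.
Definition edge_complete (e : edge G) : edge K :=
  exist _ (val e) (edge_complete_subproof e).

Definition restrict (x : edgespace R K) : edgespace R G :=
  [ffun e => x (edge_complete e)].

Fact restrict_linear : linear restrict.
Proof. by move=> a x y; apply/ffunP=> e; rewrite !ffunE. Qed.
HB.instance Definition _ := GRing.isLinear.Build R _ _ _ restrict
  restrict_linear.

Fact restrict_lineality x : x \in LK -> (qclass LG \o restrict) x = 0.
Proof.
case/vlineP=> c ->; rewrite /= linearZ; apply/eqP; rewrite qclass_eq0.
by apply: memvZ; apply/vlineP; exists 1; rewrite scale1r;
  apply/ffunP=> e; rewrite !ffunE.
Qed.

Definition restrict_quot : quotv LK -> quotv LG :=
  quotv_lift (qclass LG \o restrict).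
HB.instance Definition _ := GRing.isLinear.Build R _ _ _ restrict_quot
  (quotv_lift_linear restrict_lineality).

Lemma restrict_quotE x : restrict_quot (qclass LK x) = qclass LG (restrict x).
Proof. exact: quotv_liftE restrict_lineality x. Qed.

Fact restrict_quot_forget y : y \in forget_space -> restrict_quot y = 0.
Proof.
suff /subvP kerS : (forget_space <= lker (linfun restrict_quot))%VS.
  by move/kerS; rewrite memv_ker lfunE => /eqP.
apply/span_subvP=> _ /imageP[e eG ->]; rewrite memv_ker lfunE /=.
rewrite restrict_quotE (_ : restrict _ = 0) ?linear0 //.
apply/ffunP=> e'; rewrite !ffunE; case: eqP => // ee'.
by case/negP: eG; rewrite -ee' (valP e').
Qed.

(* The natural isomorphism (R^E(K) / L) / S -> R^E(G) / L. *)
Definition pi_target : quotv forget_space -> quotv LG := quotv_lift restrict_quot.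

Lemma pi_targetE x : pi_target (pi_graph (qclass LK x)) = qclass LG (restrict x).
Proof.
exact: etrans (quotv_liftE restrict_quot_forget _) (restrict_quotE _).
Qed.

Lemma pi_target_linear : linear pi_target.
Proof. exact: quotv_lift_linear restrict_quot_forget. Qed.

Lemma pi_target_bij : bijective pi_target.
Proof.
pose ext (y : edgespace R G) : edgespace R K :=
  [ffun e : edge K => oapp y 0 (insub (val e)) : R^o].
have extK y : restrict (ext y) = y.
  by apply/ffunP=> e; rewrite !ffunE /= valK.
apply: (@inj_surj_bij _ _ _ (fun y => pi_graph (qclass LK (ext (repr y))))).
  apply: (quotv_lift_inj restrict_quot_forget) => y.
  rewrite -[y]qclass_repr; set x := repr y.
  move/eqP; rewrite [X in X == 0]restrict_quotE qclass_eq0 => /vlineP[c xc].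
  pose z : edgespace R K := x - c *: [ffun=> 1].
  have -> : qclass LK x = qclass LK z.
    by apply/eqP; rewrite qclass_eq /z subKr memvZ // memv_line.
  have -> : z = \sum_(e : edge K) z e *: vvec R e.
    apply/ffunP=> e; rewrite sum_ffunE (bigD1 e) //= big1 ?addr0 => [|e' e'e].
      by rewrite !ffunE eqxx [RHS]mulr1.
    by rewrite !ffunE eq_sym (negPf e'e) [LHS]mulr0.
  rewrite linear_sum rpred_sum // => e _; rewrite linearZZ.
  have [eG|eG] := boolP (val e \in sedges G); last first.
    by apply/memvZ/memv_span/image_f.
  suff ze0 : z e = 0 :> R by rewrite ze0 scale0r mem0v.
  have := congr1 (fun f : edgespace R G => f (exist _ (val e) eG)) xc.
  rewrite !ffunE (_ : edge_complete _ = e); last exact: val_inj.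
  by move=> ->; rewrite subrr.
by move=> y; rewrite pi_targetE extK qclass_repr.
Qed.

End Forget.

Arguments pi_graph R {T} G x.
Arguments pi_target R {T} G x.

(** * Rational marked tropical curves, radially aligned *)

(* A combinatorial type with ends indexed by [I]: a tree, together with the
   vertex carrying each end.  The edges of the tree are the bounded edges. *)
Record comb_type (I : finType) := CombType {
  ct_vertex : finType;
  ct_graph : sgraph ct_vertex;
  ct_end : I -> ct_vertex;
  ct_tree : is_tree ct_graph;
  ct_valence : forall v : ct_vertex,
    (3 <= #|[set e in sedges ct_graph | v \in e]| + #|[set i | ct_end i == v]|)%N
}.

Section Metric.
Variables (R : realType) (V : finType) (G : sgraph V) (len : {set V} -> R).

Definition walk_length (u : V) (p : seq V) : R :=
  \sum_(e <- pairmap (fun x y => [set x; y]) u p) len e.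

Definition simple_path (u v : V) : set (seq V) :=
  [set p | [/\ path (adj G) u p, uniq (u :: p) & last u p = v]].

(* In a tree there is exactly one simple path from [u] to [v]. *)
Definition tree_dist (u v : V) : R :=
  walk_length u (xget [::] (simple_path u v)).

End Metric.

(* The ends labelled 1, ..., n are indexed by 'I_m.+1 with m = n - 1; the root
   end 1 is [ord0], and the vertices 2, ..., n of K_{n-1} are indexed by 'I_m,
   [i : 'I_m] corresponding to the end [lift ord0 i]. *)
Section Moduli.
Variables (R : realType) (m : nat).
Local Notation ends := 'I_m.+1.
Local Notation Kends := (complete ends).
Local Notation Kroot := (complete 'I_m).

(* Only the [rt_le] realized by some metric, see [rad_metric], matter; these are
   weak orderings (total preorders). *)
Record rad_type := RadType {
  rt_comb :> comb_type ends;
  rt_le : rel (ct_vertex rt_comb)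
}.

(* Length assignments of the curves of the given radially aligned type; only
   the values of [len] on edges matter. *)
Definition rad_metric (t : rad_type) : set ({set ct_vertex t} -> R) :=
  [set len | (forall e, e \in sedges (ct_graph t) -> 0 < len e) /\
     let d0 := tree_dist (ct_graph t) len (ct_end t ord0) in
     forall u v, rt_le u v = (d0 u <= d0 v)].

Definition Phi (a : {ffun ends -> R^o}) : edgespace R Kends :=
  [ffun e : edge Kends => \sum_(i in val e) a i : R^o].

Fact Phi_linear : linear Phi.
Proof.
move=> c a b; apply/ffunP=> e; rewrite !ffunE scaler_sumr -big_split /=.
by apply: eq_bigr => i _; rewrite !ffunE.
Qed.
HB.instance Definition _ := GRing.isLinear.Build R _ _ _ Phi Phi_linear.

Definition Qspace := quotv (limg (linfun Phi)).

Lemma kedge_subproof (T : finType) (i j : T) :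
  i != j -> [set i; j] \in sedges (complete T).
Proof. by move=> ij; rewrite inE cards2 ij. Qed.
Definition kedge (T : finType) (i j : T) (ij : i != j) : edge (complete T) :=
  exist _ [set i; j] (kedge_subproof ij).

(* Relatively open cones: the boundary faces of the closed cone of a type are
   the cones of other types, so their union is that of the closed cones.  The
   lengths of the (unbounded) ends play no role, being killed by [Phi]. *)
Definition rad_cone (t : rad_type) : set Qspace :=
  [set q | exists2 len, rad_metric len &
     exists2 x : edgespace R Kends,
       (forall i j (ij : i != j), x (kedge ij) =
          tree_dist (ct_graph t) len (ct_end t i) (ct_end t j)) &
       q = qclass _ x].

Definition Mrad : set Qspace := [set q | exists t : rad_type, rad_cone t q].

Definition root_edge (i : 'I_m) : edge Kends := kedge (neq_lift ord0 i).

Lemma lift_edge_subproof (e : edge Kroot) :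
  lift ord0 @: val e \in sedges Kends.
Proof. by rewrite inE card_imset ?(sedgesP (valP e)) //; exact: lift_inj. Qed.
Definition lift_edge (e : edge Kroot) : edge Kends :=
  exist _ (lift ord0 @: val e) (lift_edge_subproof e).

(* Minus the length of the common part of the paths from the root to the ends
   of [e].  For bounded edges of length 1 from the root to vertices with end
   sets I_1, ..., I_d this is -1 on the edges of the K_{I_j} and 0 elsewhere,
   that is, a representative of rho of the corresponding flat. *)
Definition psi (x : edgespace R Kends) : edgespace R Kroot :=
  [ffun e => (x (lift_edge e) - \sum_(i in val e) x (root_edge i)) / 2].

Fact psi_linear : linear psi.
Proof.
move=> c x y; apply/ffunP=> e; rewrite !ffunE.
under eq_bigr do rewrite !ffunE.
rewrite big_split /= -scaler_sumr.
set A := x _; set B := y _; set S := \sum_(i in _) _; set S' := \sum_(i in _) _.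
rewrite -[c *: S]/((c : R) * S) -[c *: A]/((c : R) * A).
rewrite -[RHS]/((c : R) * ((A - S) / 2) + (B - S') / 2 : R).
by rewrite opprD addrACA -mulrBr mulrDl mulrA.
Qed.
HB.instance Definition _ := GRing.isLinear.Build R _ _ _ psi psi_linear.

Fact psi_Phi (x : edgespace R Kends) :
  x \in limg (linfun Phi) -> (qclass (lineality R Kroot) \o psi) x = 0.
Proof.
case/memv_imgP=> a _ ->; rewrite lfunE /=; apply/eqP; rewrite qclass_eq0.
apply/vlineP; exists (- a ord0); apply/ffunP=> e; rewrite !ffunE.
have -> : \sum_(i in val (lift_edge e)) a i = \sum_(i in val e) a (lift ord0 i).
  by rewrite big_imset //= => i j _ _; exact: lift_inj.
have -> : \sum_(i in val e) Phi a (root_edge i) =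
          \sum_(i in val e) a (lift ord0 i) + a ord0 *+ 2.
  have e2 : #|val e| = 2 by exact: (@sedgesP _ Kroot _ (valP e)).
  rewrite (_ : a ord0 *+ 2 = \sum_(i in val e) a ord0); last first.
    by rewrite sumr_const e2.
  rewrite -big_split; apply: eq_bigr => i _.
  by rewrite ffunE /= big_setU1 ?inE //= big_set1 addrC.
rewrite opprD addrA subrr add0r [RHS]mulr1 mulNr; congr (- _).
by rewrite -[a ord0 *+ 2]/((a ord0 : R) *+ 2) -(mulr_natr (a ord0 : R)) mulfK ?pnatr_eq0.
Qed.

Definition Psi : Qspace -> quotv (lineality R Kroot) :=
  quotv_lift (qclass _ \o psi).

Lemma PsiE x : Psi (qclass _ x) = qclass _ (psi x).
Proof. exact: quotv_liftE psi_Phi x. Qed.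

Lemma Psi_linear : linear Psi.
Proof. exact: quotv_lift_linear psi_Phi. Qed.

Lemma Psi_bij : bijective Psi.
Proof.
pose ext (y : edgespace R Kroot) : edgespace R Kends :=
  [ffun e : edge Kends =>
     oapp y 0 (insub (lift ord0 @^-1: val e)) *+ 2 : R^o].
have extK y : psi (ext y) = y.
  apply/ffunP=> e; rewrite !ffunE big1 => [|i _]; last first.
    rewrite ffunE insubF ?mul0rn //=; apply/negbTE; rewrite inE.
    rewrite (_ : _ @^-1: _ = [set i]) ?cards1 //.
    by apply/setP=> j; rewrite !inE (inj_eq (@lift_inj _ _)).
  rewrite subr0 /= (_ : _ @^-1: _ = val e); last first.
    by apply/setP=> i; rewrite inE mem_imset //; exact: lift_inj.
  rewrite valK /= -[y e *+ 2]/((y e : R) *+ 2).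
  by rewrite -(mulr_natr (y e : R)) mulfK ?pnatr_eq0.
apply: (@inj_surj_bij _ _ _ (fun y => qclass _ (ext (repr y)))); last first.
  by move=> y; rewrite PsiE extK qclass_repr.
apply: (quotv_lift_inj psi_Phi) => x /eqP.
rewrite [X in X == 0]/= qclass_eq0 => /vlineP[c xc].
pose a : {ffun ends -> R^o} :=
  [ffun i => oapp (fun j => x (root_edge j) + c) (- c) (unlift ord0 i) : R^o].
suff -> : x = linfun Phi a by exact: memv_img (memvf _).
have a0 : a ord0 = - c by rewrite ffunE unlift_none.
have aS i : a (lift ord0 i) = x (root_edge i) + c by rewrite ffunE liftK.
clearbody a.
have sum2 (I : finType) (F : I -> R) i j :
    i != j -> \sum_(k in [set i; j]) F k = F i + F j.
  by move=> ij; rewrite big_setU1 ?inE //= big_set1.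
rewrite lfunE; apply/ffunP=> e; rewrite ffunE.
have e2 : #|val e| == 2 by apply/eqP; exact: (@sedgesP _ Kends _ (valP e)).
have [p [q [pq eE]]] := cards2P _ e2.
rewrite eE [RHS](sum2 _ a) //.
have aroot i : e = root_edge i -> x e = a ord0 + a (lift ord0 i).
  by move=> ->; rewrite a0 aS addrCA addNr addr0.
move: pq eE; have [i ->|->] := unliftP ord0 p; last first.
  have [j ->|->] := unliftP ord0 q; last by rewrite eqxx.
  by move=> _ eE; apply: aroot; exact: val_inj.
have [j ->|-> _ eE] := unliftP ord0 q; last first.
  by rewrite addrC; apply: aroot; apply: val_inj; rewrite eE setUC.
rewrite (inj_eq (@lift_inj _ _)) => ij eE.
have := congr1 (fun y : edgespace R Kroot => y (kedge ij)) xc.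
rewrite !ffunE /= [in LHS](sum2 _ (fun k => x (root_edge k))) //.
have -> : lift_edge (kedge ij) = e.
  by apply: val_inj; rewrite eE /= imsetU !imset_set1.
set A : R := x e; set B : R := x (root_edge i); set C : R := x (root_edge j).
move=> H; have {H} xe : (A - (B + C)) / 2 = c by rewrite [LHS]H [LHS]mulr1.
rewrite !aS -[LHS]/A -/B -/C -[LHS](subrK (B + C)).
rewrite -[A - _](@divfK R 2) ?pnatr_eq0 // xe -[RHS]/(B + c + (C + c) : R).
by rewrite mulr_natr mulr2n [LHS]addrC addrACA.
Qed.

End Moduli.

Arguments Mrad R m : clear implicits.
Arguments Psi R m x : clear implicits.

(* Main.v *)
Require Import Defs.
From mathcomp Require Import boolp classical_sets reals.
From mathcomp Require Import all_boot all_order all_algebra.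

(** Write lambda(i, j) for the length of the common part of the paths from the
root to the ends i and j.  Up to the identifications the image of a curve is the
class of (- lambda(i, j)) over the edges ij of the graph, and lambda is an
ultrametric similarity: lambda(i, k) >= min(lambda(i, j), lambda(j, k)).  Hence
each sublevel set {- lambda <= a} contains every edge of the graph whose
endpoints it connects, that is, it is a flat, and a function whose sublevel sets
are flats is a nonnegative combination of a flag modulo constants.  Conversely,
for a flag with weights c_F, the sum lambda(i, j) of the c_F over the flats F
connecting i and j is an ultrametric similarity, since the flats form a chain;
the balls of lambda, ordered by inclusion, are the vertices of a tree which
realizes lambda up to an additive constant. *)

Set Implicit Arguments.
Unset Strict Implicit.
Unset Printing Implicit Defensive.

Import Order.TTheory GRing.Theory Num.Theory.
Local Open Scope ring_scope.

(** * Simple paths in trees *)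

Section CommonPrefix.
Variable T : eqType.
Implicit Types s t c : seq T.

Fixpoint lcp s t :=
  match s, t with
  | x :: s', y :: t' => if x == y then x :: lcp s' t' else [::]
  | _, _ => [::]
  end.

(** An exhausted sequence diverges from every other, so a path that is a prefix of the other needs
    no separate treatment. *)
Definition diverge s t :=
  match s, t with x :: _, y :: _ => x != y | _, _ => true end.

Lemma lcpP s t :
  exists a b, [/\ s = lcp s t ++ a, t = lcp s t ++ b & diverge a b].
Proof.
elim: s t => [|x s IH] [|y t] /=.
- by exists [::], [::].
- by exists [::], (y :: t).
- by exists (x :: s), [::].
case: eqP => [<-|/eqP xy]; last by exists (x :: s), (y :: t).
by have [a [b [sE tE ab]]] := IH t; exists a, b; rewrite /= -sE -tE.
Qed.

Lemma lcpC s t : lcp s t = lcp t s.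
Proof.
elim: s t => [|x s IH] [|y t] //=; rewrite eq_sym.
by case: eqP => // ->; rewrite IH.
Qed.

Lemma prefix_lcpl s t : prefix (lcp s t) s.
Proof. by have [a [b [sE _ _]]] := lcpP s t; rewrite [X in prefix _ X]sE prefix_prefix. Qed.

Lemma prefix_lcpr s t : prefix (lcp s t) t.
Proof. by rewrite lcpC prefix_lcpl. Qed.

Lemma prefix_lcp c s t : prefix c s -> prefix c t -> prefix c (lcp s t).
Proof.
elim: c s t => [|x c IH] [|y s] [|z t] //=; first by rewrite prefix0s.
by move=> /andP[/eqP<- cs] /andP[/eqP<- ct]; rewrite eqxx /= eqxx IH.
Qed.

Lemma prefix_linear c d s : prefix c s -> prefix d s -> prefix c d || prefix d c.
Proof.
elim: s c d => [|x s IH] [|y c] [|z d] //= /andP[/eqP-> cs] /andP[/eqP-> ds].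
by rewrite eqxx /=; exact: IH.
Qed.

End CommonPrefix.

Section SimplePaths.
Variables (V : finType) (G : sgraph V).
Implicit Types (u v w r : V) (p q : seq V).

Lemma adj_sym (F : {set {set V}}) : symmetric (adj F).
Proof. by move=> x y; rewrite /adj /= eq_sym setUC. Qed.

Lemma rev_adj_path (F : {set {set V}}) u p :
  path (adj F) (last u p) (rev (belast u p)) = path (adj F) u p.
Proof. by rewrite rev_path; apply: eq_path => x y; rewrite adj_sym. Qed.

(** At the first vertex [x] of [q] lying on [p], the two segments from [u] to [x] close up to a
    cycle without repetitions. Acyclicity bounds its size by 2, so both paths start with [x],
    against divergence. *)
Lemma acyclic_diverge u p q :
  graph_acyclic G -> path (adj G) u p -> path (adj G) u q ->
  uniq (u :: p) -> uniq (u :: q) -> diverge p q -> ~~ has (mem p) q.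
Proof.
move=> acG pP qP /= /andP[up pU] /andP[uq qU] pq; apply/negP=> qp.
case: (split_find qp) qP uq qU pq => x q1 q2 /= xp q1p.
case/splitPr: xp pP up pU q1p => p1 p2.
rewrite -cat_rcons !cat_path => /andP[p1x _] up pU q1p.
case/andP=> q1P _ uq qU pq.
have c_path : path (adj G) u (rcons (p1 ++ x :: rev q1) u).
  rewrite -cat_rcons rcons_cat cat_path p1x last_rcons -rev_cons.
  by have := rev_adj_path G u (rcons q1 x); rewrite last_rcons belast_rcons q1P.
have c_uniq : uniq (u :: p1 ++ x :: rev q1).
  rewrite /= mem_cat inE mem_rev; move: up uq.
  rewrite !mem_cat !mem_rcons !inE !negb_or => /andP[/andP[-> ->] _].
  case/andP=> /andP[_ ->] _ /=; rewrite -cat_rcons cat_uniq rev_uniq.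
  move: pU; rewrite cat_uniq => /and3P[-> _ _].
  move: qU; rewrite cat_uniq rcons_uniq => /andP[/andP[_ ->] _]; rewrite andbT /=.
  by apply: contra q1p => /hasP[y]; rewrite mem_rev => yq yp; apply/hasP; exists y;
    rewrite //= mem_cat yp.
have /= := acG (u :: p1 ++ x :: rev q1) (introT andP (conj c_path c_uniq)).
rewrite size_cat /= size_rev => sz.
by move: sz pq; case: (p1) => [|? ?]; case: (q1) => [|? ?] //=; rewrite ?eqxx // ?addnS.
Qed.

Lemma simple_path_unique u v p q :
  graph_acyclic G -> simple_path G u v p -> simple_path G u v q -> p = q.
Proof.
move=> acG; elim: p q u => [|x p IH] [|y q] u [] // pP pU lp [] // qP qU lq.
- by case/andP: qU => /negP[]; rewrite (lp : u = v) -lq; exact: (mem_last y q).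
- by case/andP: pU => /negP[]; rewrite (lq : u = v) -lp; exact: (mem_last x p).
have [xy|xy] := eqVneq x y.
  subst y; case/andP: pP pU qP qU => _ pP /andP[_ pU] /andP[_ qP] /andP[_ qU].
  by congr cons; apply: (IH q x); split.
have /hasP[] := acyclic_diverge acG pP qP pU qU xy.
by exists v; [rewrite -lq; exact: (mem_last y q)|rewrite /= -lp; exact: (mem_last x p)].
Qed.

Lemma simple_path_exists u v : graph_connected G -> exists p, simple_path G u v p.
Proof.
by move=> /(_ u v)/connectP[p pP ->]; case/shortenP: pP => q *; exists q.
Qed.

(** * Path lengths and Gromov products *)

Variables (R : realType) (len : {set V} -> R).

Lemma walk_length_cat u p q :
  walk_length len u (p ++ q) = walk_length len u p + walk_length len (last u p) q.
Proof. by rewrite /walk_length pairmap_cat big_cat. Qed.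

Lemma walk_length_cons u x p :
  walk_length len u (x :: p) = len [set u; x] + walk_length len x p.
Proof. by rewrite /walk_length /= big_cons. Qed.

Lemma walk_length_rev u p :
  walk_length len (last u p) (rev (belast u p)) = walk_length len u p.
Proof.
elim: p u => // x p IH u.
rewrite [last u _]/= [belast u _]/=.
rewrite rev_cons -cats1 walk_length_cat IH !walk_length_cons addrC.
have -> : last (last x p) (rev (belast x p)) = x.
  by case: p {IH} => //= y p; rewrite rev_cons last_rcons.
by rewrite setUC; congr (_ + _); rewrite /walk_length big_nil addr0.
Qed.

Lemma tree_distE u v p :
  graph_acyclic G -> simple_path G u v p ->
  tree_dist G len u v = walk_length len u p.
Proof.
move=> acG pP; congr walk_length.
by apply: (simple_path_unique acG _ pP); apply: xgetPex; exists p.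
Qed.

(* The path from [u] to [v] is obtained from the paths from [r] to [u] and [v]
   by removing their common part. *)
Lemma tree_dist_lcp r u v p q :
  graph_acyclic G -> simple_path G r u p -> simple_path G r v q ->
  tree_dist G len u v =
  tree_dist G len r u + tree_dist G len r v - walk_length len r (lcp p q) *+ 2.
Proof.
move=> acG rp rq; rewrite (tree_distE acG rp) (tree_distE acG rq).
have [a [b [pE qE ab]]] := lcpP p q; move: (lcp p q) pE qE => c pE qE.
subst p q; rewrite !walk_length_cat.
set x := last r c; case: rp rq => rp pU <- [rq qU <-]; rewrite !last_cat -/x.
have split_uniq (s : seq V) : uniq (r :: c ++ s) -> uniq (x :: s).
  rewrite -cat_cons lastI cat_rcons cat_uniq => /and3P[_ _]; exact.
move: rp rq; rewrite !cat_path => /andP[_ aP] /andP[_ bP].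
have dis := acyclic_diverge acG aP bP (split_uniq _ pU) (split_uniq _ qU) ab.
have /= /andP[xa aU] := split_uniq _ pU; have /= /andP[xb bU] := split_uniq _ qU.
have last_rev : last (last x a) (rev (belast x a)) = x.
  by case: (a) => //= y s; rewrite rev_cons last_rcons.
(* The path runs from [u] back along [a] to the branching vertex [x], then along [b] to [v]. *)
rewrite (@tree_distE _ _ (rev (belast x a) ++ b)) //; last first.
  split; last by rewrite last_cat last_rev.
    by rewrite cat_path rev_adj_path aP last_rev.
  rewrite -cat_cons -rev_rcons -lastI cat_uniq rev_uniq /= xa aU bU andbT.
  rewrite andbT /=; apply: contra dis => /hasP[y yb]; rewrite mem_rev inE => /predU1P[yx|ya].
    by rewrite -yx yb in xb.
  by apply/hasP; exists y.
rewrite walk_length_cat walk_length_rev last_rev mulr2n.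
by rewrite addrACA [RHS]addrAC subrr add0r.
Qed.

(** With [u] itself as root, the formula of [tree_dist_lcp] is symmetric in the two end vertices. *)
Lemma tree_distC u v : is_tree G -> tree_dist G len u v = tree_dist G len v u.
Proof.
case=> con acy; have [p pP] := simple_path_exists u u con.
have [q qP] := simple_path_exists u v con.
rewrite (tree_dist_lcp acy pP qP) (tree_dist_lcp acy qP pP) lcpC.
by rewrite [tree_dist _ _ u v + _]addrC.
Qed.

Lemma walk_length_ge0 u p :
  (forall e, e \in sedges G -> 0 <= len e) -> path (adj G) u p ->
  0 <= walk_length len u p.
Proof.
move=> len_ge0; elim: p u => [|x p IH] u; first by rewrite /walk_length big_nil.
case/andP=> /andP[_ ux] /IH; rewrite walk_length_cons.
by apply: addr_ge0; exact: len_ge0.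
Qed.

(** The Gromov product based at [r]. In a tree it is the length of the common part of the paths from
    [r], that is, the lambda of the introduction. *)
Definition gromov r u v : R :=
  (tree_dist G len r u + tree_dist G len r v - tree_dist G len u v) / 2.

Lemma gromov_lcp r u v p q :
  graph_acyclic G -> simple_path G r u p -> simple_path G r v q ->
  gromov r u v = walk_length len r (lcp p q).
Proof.
move=> acG rp rq; rewrite /gromov (tree_dist_lcp acG rp rq) subKr.
by rewrite -[_ *+ 2]mulr_natr mulfK ?pnatr_eq0.
Qed.

(** The common parts [lcp p q] and [lcp q s] are prefixes of the same path [q], so one is a prefix
    of the other. The shorter one is then a prefix of both [p] and [s], and length is monotone in
    prefixes. *)
Lemma gromov_ultrametric r u v w :
  is_tree G -> (forall e, e \in sedges G -> 0 <= len e) ->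
  Num.min (gromov r u v) (gromov r v w) <= gromov r u w.
Proof.
case=> conG acG len_ge0.
have [p pP] := simple_path_exists r u conG.
have [q qP] := simple_path_exists r v conG.
have [s sP] := simple_path_exists r w conG.
rewrite (gromov_lcp acG pP qP) (gromov_lcp acG qP sP) (gromov_lcp acG pP sP).
have mono c : prefix c (lcp p s) -> walk_length len r c <= walk_length len r (lcp p s).
  case/prefixP=> d dE; rewrite dE walk_length_cat lerDl walk_length_ge0 //.
  case: pP; have /prefixP[e ->] := prefix_lcpl p s.
  by rewrite dE !cat_path => /andP[/andP[]].
rewrite ge_min; have /orP[le12|le21] := prefix_linear (prefix_lcpr p q) (prefix_lcpl q s).
  apply/orP; left; apply/mono/prefix_lcp; first exact: prefix_lcpl.
  exact: prefix_trans le12 (prefix_lcpr _ _).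
apply/orP; right; apply/mono/prefix_lcp; last exact: prefix_lcpr.
exact: prefix_trans le21 (prefix_lcpl _ _).
Qed.

End SimplePaths.

(** * Flats *)

Section Flats.
Variable T : finType.
Implicit Types (G : sgraph T) (F : {set {set T}}).

Lemma adj_connect_sym F : connect_sym (adj F).
Proof. exact/sym_connect_sym/adj_sym. Qed.

Lemma sub_adj F F' : F \subset F' -> subrel (connect (adj F)) (connect (adj F')).
Proof.
move=> /subsetP FF'; apply: connect_sub => x y /andP[xy xyF].
by apply: connect1; rewrite /adj /= xy FF'.
Qed.

(** An isolated vertex is a component by itself, so it adds one to both terms of the difference. *)
Lemma grankE F : grank F = (#|T| - n_comp (adj F) T)%N.
Proof.
rewrite (n_compC (mem (cover F))) /grank -(cardC (mem (cover F))).
suff -> : n_comp (adj F) [predC cover F] = #|[predC cover F]| by rewrite subnDr.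
apply: eq_card => x; rewrite !inE andbC; case: (boolP (x \in cover F)) => //= xF.
have /connectP[[|y p] /=] := connect_root (adj F) x; first by rewrite /roots => _ ->; rewrite eqxx.
case/andP=> /andP[_ xyF] _ _; case/negP: xF.
by apply/bigcupP; exists [set x; y]; rewrite // set21.
Qed.

Lemma n_comp_image F :
  n_comp (adj F) T = #|[set fingraph.root (adj F) u | u : T]|.
Proof.
apply: eq_card => u; rewrite !inE andbT; apply/eqP/imsetP=> [<-|[v _ ->]].
  by exists u.
by rewrite root_root //; exact: adj_connect_sym.
Qed.

Lemma ltn_grankU F x y :
  x != y -> (grank F < grank ([set x; y] |: F))%N = ~~ connect (adj F) x y.
Proof.
move=> xy; set F' := _ |: F.
have FF' := sub_adj (subsetUr [set [set x; y]] F : F \subset F').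
have [cxy|ncxy] := boolP (connect (adj F) x y).
  rewrite !grankE; apply/negbTE; rewrite -leqNgt; apply: eq_leq; congr (_ - _)%N.
  apply: (eq_n_comp _ (mem T)) => u v; apply/idP/idP; last exact: FF'.
  apply: connect_sub => {}u {}v /andP[uv]; rewrite in_setU1 => /predU1P[uvE|uvF].
    have: u \in [set x; y] by rewrite -uvE set21.
    have: v \in [set x; y] by rewrite -uvE set22.
    by case/set2P=> -> /set2P[] ->; rewrite ?connect0 // adj_connect_sym.
  by apply: connect1; rewrite /adj /= uv.
have rootF' u : fingraph.root (adj F') (fingraph.root (adj F) u) = fingraph.root (adj F') u.
  apply/esym/fingraph.rootP; first exact: adj_connect_sym.
  exact/FF'/connect_root.
have ltn_n : (n_comp (adj F') T < n_comp (adj F) T)%N.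
  rewrite !n_comp_image.
  (* The components for [F'] are the image of those for [F], under a map that identifies the
     components of [x] and [y]. *)
  have -> : [set fingraph.root (adj F') u | u : T] =
            fingraph.root (adj F') @: [set fingraph.root (adj F) u | u : T].
    by rewrite -imset_comp; apply: eq_imset => u /=; rewrite rootF'.
  rewrite ltn_neqAle leq_imset_card andbT; apply/imset_injP => inj.
  case/negP: ncxy; rewrite -root_connect; last exact: adj_connect_sym.
  apply/eqP/inj; rewrite ?imset_f // !rootF'.
  apply/fingraph.rootP; first exact: adj_connect_sym.
  by apply: connect1; rewrite /adj /= xy setU11.
(* Subtraction is truncated: strictness also needs fewer components for [F'] than vertices. *)
by rewrite !grankE ltn_sub2l // (leq_trans ltn_n) // max_card.
Qed.

Lemma sgraph_edge G e : e \in sedges G -> exists x y, x != y /\ e = [set x; y].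
Proof.
by move=> /sedgesP/eqP/cards2P[x [y [xy ->]]]; exists x, y.
Qed.

Lemma sgraph_edge_neq G x y : [set x; y] \in sedges G -> x != y.
Proof. by move=> /sedgesP; rewrite cards2; case: eqP. Qed.

(** By [ltn_grankU], adding an edge leaves the rank unchanged exactly when [F] already connects its
    endpoints. *)
Lemma flatP G F :
  flat G F <->
  F \subset sedges G /\
  forall x y, [set x; y] \in sedges G -> connect (adj F) x y -> [set x; y] \in F.
Proof.
split=> -[FG flatF]; split=> //.
  move=> x y xyG; apply: contraTT => xyF; rewrite -ltn_grankU ?(sgraph_edge_neq xyG) //.
  exact: flatF.
move=> e eG; have [x [y [xy eE]]] := sgraph_edge eG; rewrite {}eE in eG *.
by move=> xyF; rewrite ltn_grankU //; apply: contra xyF; exact: flatF.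
Qed.

End Flats.

(** * Functions whose sublevel sets are flats *)

Section LevelSets.
Variables (R : realType) (T : finType) (G : sgraph T).
Local Notation L := (lineality R G).

Lemma qclass_shift (y z : edgespace R G) (c : R) :
  (forall e, y e = z e + c) -> qclass L y = qclass L z.
Proof.
move=> yz; apply/eqP; rewrite qclass_eq; apply/vlineP; exists c.
by apply/ffunP=> e; rewrite !ffunE yz addrAC subrr add0r [RHS]mulr1.
Qed.

Lemma rho_sum (Fs : seq {set {set T}}) (c : {set {set T}} -> R) :
  \sum_(F <- Fs) c F *: rho R G F =
  qclass L [ffun e => - \sum_(F <- Fs | val e \in F) c F : R^o].
Proof.
under eq_bigr do rewrite /rho -linearZ.
rewrite -linear_sum /=; congr qclass; apply/ffunP=> e.
rewrite sum_ffunE ffunE -sumrN [RHS]big_mkcond; apply: eq_bigr => F _.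
rewrite !ffunE sum_ffunE scalerN; case: ifP => eF.
  rewrite (bigD1 e) //= big1 => [|e' /andP[_ e'e]].
    by rewrite ffunE eqxx addr0; congr (- _); exact: mulr1.
  by rewrite ffunE eq_sym (negPf e'e).
rewrite big1 ?scaler0 ?oppr0 // => e' e'F; rewrite ffunE; case: eqP => // ee'.
by rewrite ee' e'F in eF.
Qed.

Definition level (y : edgespace R G) (t : R) : {set {set T}} :=
  [set val e | e : edge G & (y e : R) <= t].

Lemma in_level y t (e : edge G) : (val e \in level y t) = ((y e : R) <= t).
Proof. by rewrite /level mem_imset ?inE //; exact: val_inj. Qed.

Lemma level_sub y t : level y t \subset sedges G.
Proof. by apply/subsetP=> _ /imsetP[e _ ->]; exact: valP. Qed.

(** Each level set below the maximum is weighted by the gap to the next value of [y]. The weights of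
    the levels containing [e] telescope to the maximum minus [y e], so the combination of the rays
    represents [y] up to a constant. *)
Lemma Bprime_level y : (forall t, flat G (level y t)) -> Bprime R G (qclass L y).
Proof.
move=> flaty.
pose ss : seq R := sort <=%R (undup (codom y)).
(* [N] is the index of the largest value: its level is the whole edge set and must stay out of the
   flag. Without edges, [N] is 0 and the flag is empty. *)
pose S i := nth 0 ss i; pose N := (size ss).-1.
have ss_sorted : sorted <%R ss by rewrite sort_lt_sorted undup_uniq.
have ssP e : (y e : R) \in ss by rewrite mem_sort mem_undup codom_f.
have SP i : (i < size ss)%N -> exists e, y e = S i.
  move=> iN; have := mem_nth 0 iN; rewrite mem_sort mem_undup => /codomP[e ye].
  by exists e.
have Smono : {in gtn (size ss) &, {mono S : i j / (i <= j)%N >-> i <= j}}.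
  exact: lt_sorted_leq_nth.
have ltN i : (i < N)%N -> (i.+1 < size ss)%N.
  by rewrite /N; case: (size ss).
have proper_level i : (i < N)%N -> level y (S i) \proper level y (S i.+1).
  move=> iN; have i1 := ltN _ iN; have i0 := ltnW i1.
  apply/properP; split.
    apply/subsetP=> _ /imsetP[e ye ->]; rewrite inE in ye; rewrite in_level.
    by apply: le_trans ye _; rewrite Smono.
  have [e ye] := SP _ i1; exists (val e); rewrite in_level ye ?lexx //.
  by rewrite Smono // ltnn.
pose Fs := mkseq (fun i => level y (S i)) N.
have Fs_sorted : sorted (fun F F' : {set {set T}} => F \proper F') Fs.
  apply/(sortedP set0)=> i; rewrite size_mkseq => iN.
  by rewrite !nth_mkseq ?proper_level // ltnW.
have Fs_uniq : uniq Fs.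
  apply: sorted_uniq Fs_sorted => [F1 F2 F3|F]; [exact: proper_trans|exact: properxx].
(* Weights are indexed by sets, so the gap belonging to [F] is found through the position of [F] in
   the flag. *)
pose c F : R := if F \in Fs then S (index F Fs).+1 - S (index F Fs) else 0.
have cE i : (i < N)%N -> c (level y (S i)) = S i.+1 - S i.
  move=> iN; have -> : level y (S i) = nth set0 Fs i by rewrite nth_mkseq.
  by rewrite /c mem_nth ?size_mkseq // index_uniq ?size_mkseq.
exists Fs.
  split=> // F /mapP[i]; rewrite mem_iota => iN ->; split=> //.
    have [e ye] := SP i (ltnW (ltN _ iN)); rewrite proper0; apply/set0Pn.
    by exists (val e); rewrite in_level ye.
  exact: proper_sub_trans (proper_level _ iN) (level_sub _ _).
exists c => [F|].
  have [FF|FF] := boolP (F \in Fs); last by rewrite /c (negPf FF).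
  have /mapP[i] := FF; rewrite mem_iota => iN ->; rewrite cE //.
  by rewrite subr_ge0 Smono // ?inE ?ltN // ltnW // ltN.
rewrite rho_sum; apply: (@qclass_shift _ _ (S N)) => e; rewrite ffunE.
rewrite /Fs /mkseq big_map.
(* The edge [e] lies in the level of [S i] exactly from the index of its own value on. *)
have -> : (\sum_(i <- iota 0 N | val e \in level y (S i)) c (level y (S i)) : R^o) =
          \sum_(index (y e : R) ss <= i < N) (S i.+1 - S i).
  rewrite (big_nat_widenl _ 0) // /index_iota subn0.
  rewrite big_seq_cond [RHS]big_seq_cond; apply: eq_big => [i|i].
    rewrite mem_iota; case iN: (i < N)%N; rewrite ?andbF //= in_level.
    rewrite -{1}(nth_index 0 (ssP e)) Smono ?inE ?index_mem //.
    exact: ltnW (ltN _ iN).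
  by rewrite mem_iota => /andP[iN _]; rewrite cE.
have eN : (index (y e : R) ss <= N)%N.
  by move: (ssP e); rewrite -index_mem /N; case: (size ss).
by rewrite telescope_sumr // /S nth_index // opprB addrNK.
Qed.

End LevelSets.

(** * Rooted trees given by a parent function *)

Section ParentTree.
Variables (V : finType) (r : V) (par : V -> V) (rk : V -> nat).
(** Ranks grow towards the root: iterated parents reach [r], and distinct vertices have distinct
    parent edges. *)
Hypothesis rk_par : forall v, v != r -> (rk v < rk (par v))%N.
Implicit Types (u v w : V) (p : seq V).

Lemma par_neq v : v != r -> v != par v.
Proof. by move=> /rk_par; apply: contraTneq => <-; rewrite ltnn. Qed.

Definition par_edges : {set {set V}} := [set [set v; par v] | v in predC1 r].

Fact par_edges_card e : e \in par_edges -> #|e| = 2.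
Proof. by case/imsetP=> v vr ->; rewrite cards2 par_neq. Qed.

Definition par_graph : sgraph V := SGraph par_edges_card.

Lemma set2_eq (T : finType) (a b c d : T) :
  [set a; b] = [set c; d] -> (a = c /\ b = d) \/ (a = d /\ b = c).
Proof.
move=> E; have: a \in [set c; d] by rewrite -E set21.
have: b \in [set c; d] by rewrite -E set22.
have: c \in [set a; b] by rewrite E set21.
have: d \in [set a; b] by rewrite E set22.
by do 4 case/set2P=> ?; subst; auto.
Qed.

Lemma par_adjP u v :
  reflect (u != r /\ v = par u \/ v != r /\ u = par v) (adj par_graph u v).
Proof.
apply: (iffP andP) => [[uv /imsetP[w wr /set2_eq[] [-> ->]]]|[] [ur ->]].
- by left.
- by right.
- by split; [exact: par_neq|apply/imsetP; exists u].
- by split; [rewrite eq_sym par_neq|apply/imsetP; exists v; rewrite // setUC].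
Qed.

Lemma par_edge_inj u v :
  u != r -> v != r -> [set u; par u] = [set v; par v] -> u = v.
Proof.
move=> /rk_par ur /rk_par vr /set2_eq[[] //|[uv vu]].
by move: ur; rewrite vu => /ltn_trans/(_ vr); rewrite -uv ltnn.
Qed.

Lemma par_connected : graph_connected par_graph.
Proof.
have conr v : connect (adj par_graph) v r.
  (* The induction is on the gap between the rank of [v] and the maximal rank, which shrinks on
     passing to the parent. *)
  have [n] := ubnP (\max_u rk u - rk v); elim: n v => // n IH v.
  rewrite ltnS => vn; have [->|vr] := eqVneq v r; first exact: connect0.
  have vp : connect (adj par_graph) v (par v).
    by apply/connect1/par_adjP; left.
  apply: connect_trans vp (IH _ _); apply: leq_trans vn.
  apply: ltn_sub2l (rk_par vr); apply: leq_trans (rk_par vr) _.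
  exact: leq_bigmax.
by move=> u v; apply: connect_trans (conr u) _; rewrite adj_connect_sym.
Qed.

(** A vertex of minimal rank on a cycle has no child there, so both its neighbours on the cycle are
    its parent and coincide. *)
Lemma par_acyclic : graph_acyclic par_graph.
Proof.
case=> // x c cP; have xc : x \in x :: c := mem_head _ _.
case: (arg_minnP rk xc) => v vc vmin.
have [i s sE] := rot_to vc.
have /andP[] : ucycle (adj par_graph) (v :: s) by rewrite -sE rot_ucycle.
rewrite -(size_rot i) sE.
have {vmin} nbr w : w \in v :: s -> adj par_graph v w -> w = par v.
  rewrite -sE mem_rot => wc /par_adjP[[]|[/rk_par wr vw]] //.
  by move: wr; rewrite -vw ltnNge vmin.
case: s nbr {sE} => [|y s] // nbr /=; rewrite rcons_path => /and3P[vy _ sv].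
case/and3P=> _ ys _; rewrite !ltnS; case: s nbr sv ys => // z s nbr sv.
case/negP; have -> : y = par v by apply: nbr; rewrite // !inE eqxx orbT.
rewrite -(nbr (last y (z :: s))); first exact: (mem_last z s).
  by do 2 (rewrite in_cons; apply/orP; right); exact: (mem_last z s).
by rewrite adj_sym.
Qed.

Lemma par_tree : is_tree par_graph.
Proof. by split; [exact: par_connected|exact: par_acyclic]. Qed.

Definition child : rel V := [rel u v | (v != r) && (par v == u)].

(** A simple path from the root only descends: after a step down, a step up would return to the
    vertex just left. The induction allows any start [u] whose parent is not on the rest of the
    path. *)
Lemma root_path_child v p : simple_path par_graph r v p -> path child r p.
Proof.
case=> pP pU _; suff gen u q : path (adj par_graph) u q -> uniq (u :: q) ->
    (u != r -> par u \notin q) -> path child u q by apply: gen; rewrite ?eqxx.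
elim: q u {pP pU} => // w q IH u.
case/andP=> uw wq /andP[uq qU] pu; apply/andP; split.
  case/par_adjP: uw => [[ur wE]|[wr ->]]; last by rewrite /child /= wr eqxx.
  by move: (pu ur); rewrite wE inE eqxx.
apply: IH => // wr.
case/par_adjP: uw => [[ur wE]|[_ <-]].
  by move: (pu ur); rewrite wE inE eqxx.
by move: uq; rewrite inE negb_or => /andP[].
Qed.

Variables (R : realType) (h : V -> R).

(** Lengths are functions of vertex sets. On an edge the sum has a single term, by
    [par_edge_inj]. *)
Definition par_len (e : {set V}) : R :=
  \sum_(v | (v != r) && (e == [set v; par v])) (h v - h (par v)).

Lemma par_lenE v : v != r -> par_len [set v; par v] = h v - h (par v).
Proof.
move=> vr; rewrite /par_len (bigD1 v) ?vr ?eqxx //= big1 ?addr0 // => w.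
by case/andP=> /andP[wr /eqP vw] /eqP[]; apply/esym/par_edge_inj.
Qed.

Lemma walk_length_child u p :
  path child u p -> walk_length par_len u p = h (last u p) - h u.
Proof.
elim: p u => [|v p IH] u; first by rewrite /walk_length big_nil subrr.
case/andP=> /andP[vr /eqP uE] pP; rewrite walk_length_cons IH // -uE.
by rewrite setUC par_lenE // addrC addrA addrNK.
Qed.

End ParentTree.

(** * The tree of balls of an ultrametric *)

Section BallTree.
Variables (R : realType) (m : nat).
Local Notation I := 'I_m.
Variable lam : I -> I -> R.
Hypothesis lamC : forall i j, lam i j = lam j i.
Hypothesis lam_ultra : forall i j k, Num.min (lam i j) (lam j k) <= lam i k.
Variables (i0 i1 : I) (i01 : i0 != i1).
Implicit Types i j k : I.

Lemma lam_trans (t : R) i j k : t <= lam i j -> t <= lam j k -> t <= lam i k.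
Proof. by move=> ij jk; apply: le_trans (lam_ultra i j k); rewrite le_min ij. Qed.

Lemma lam_diag i j : lam i j <= lam i i.
Proof. by apply: (@lam_trans _ i j i); rewrite // lamC. Qed.

Definition lam_ball i j : {set I} := [set k | lam i j <= lam i k].

(** Only balls spanned by two distinct points become vertices: the paths to these points branch
    there, on which [ball_valence] rests. *)
Definition is_ball (B : {set I}) :=
  [exists p : I * I, (p.1 != p.2) && (B == lam_ball p.1 p.2)].

Definition ball_vertex := {B : {set I} | is_ball B}.
Implicit Types B C : ball_vertex.

Lemma ball_subproof i j : i != j -> is_ball (lam_ball i j).
Proof. by move=> ij; apply/existsP; exists (i, j); rewrite ij eqxx. Qed.

Definition ball i j (ij : i != j) : ball_vertex 
  := exist is_ball _ (ball_subproof ij).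

(* The radius does not depend on the pair spanning the ball, see [height_ball]. *)
Definition height B : R :=
  if [pick p : I * I | (p.1 != p.2) && (val B == lam_ball p.1 p.2)] is Some p
  then lam p.1 p.2 else 0.

Lemma heightP B : exists i j,
  [/\ i != j, i \in val B, j \in val B, height B = lam i j &
      val B = [set k | height B <= lam i k]].
Proof.
rewrite /height; case: pickP => [[i j] /= /andP[ij /eqP BE]|noB].
  by exists i, j; rewrite BE !inE lexx lam_diag.
by have /existsP[p] := valP B; rewrite noB.
Qed.

(** As in any ultrametric space, every point of a ball is a centre of it. *)
Lemma ballE B k : k \in val B -> val B = [set l | height B <= lam k l].
Proof.
have [i [j [_ _ _ _ BE]]] := heightP B; rewrite {1}BE inE => ik.
rewrite BE; apply/setP=> l; rewrite !inE; apply/idP/idP => [|kl].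
  by apply: lam_trans; rewrite lamC.
exact: lam_trans ik kl.
Qed.

Lemma ball_linear B C k :
  k \in val B -> k \in val C -> (val B \subset val C) || (val C \subset val B).
Proof.
move=> /ballE-> /ballE->; case: (leP (height B) (height C)) => [BC|/ltW CB].
  by apply/orP; right; apply/subsetP=> l; rewrite !inE; apply: le_trans.
by apply/orP; left; apply/subsetP=> l; rewrite !inE; apply: le_trans.
Qed.

(** Since [lam] is a similarity, heights increase away from the root; this makes the edge lengths
    positive. *)
Lemma height_proper B C : val B \proper val C -> height C < height B.
Proof.
case/andP=> BC; have [k [_ [_ kB _ _ _]]] := heightP B.
rewrite (ballE kB) (ballE (subsetP BC _ kB)); case: ltP => // hBC /negP[].
by apply/subsetP=> l; rewrite !inE; exact: le_trans.
Qed.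

Lemma ball_l i j (ij : i != j) : i \in val (ball ij).
Proof. by rewrite inE lam_diag. Qed.

Lemma ball_r i j (ij : i != j) : j \in val (ball ij).
Proof. by rewrite inE lexx. Qed.

Lemma ball_min i j (ij : i != j) C :
  i \in val C -> j \in val C -> val (ball ij) \subset val C.
Proof.
move=> /ballE CE; rewrite CE inE => hC; apply/subsetP=> k; rewrite !inE.
exact: le_trans.
Qed.

Lemma height_ball i j (ij : i != j) : height (ball ij) = lam i j.
Proof.
have := ball_r ij; rewrite (ballE (ball_l ij)) inE => hle.
apply/eqP; rewrite eq_le hle /=.
have [a [b [_ aB bB -> _]]] := heightP (ball ij); move: aB bB; rewrite !inE.
by rewrite [lam i a]lamC; apply: lam_trans.
Qed.

(** A pair of distinct points with least similarity spans everything; [i0] and [i1] provide a first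
    such pair. *)
Lemma ball_root_exists : exists B, val B == setT.
Proof.
pose f (p : I * I) := lam p.1 p.2.
case: (@arg_minP _ _ _ (i0, i1) (fun p => p.1 != p.2) f i01) => -[i j] /= ij le_ij.
exists (ball ij).
apply/eqP/setP=> k; rewrite !inE; have [<-|ik] := eqVneq i k; first exact: lam_diag.
exact: (le_ij (i, k)).
Qed.

Definition ball_root : ball_vertex := xchoose (ball_root_exists).

Local Notation r := ball_root.

Lemma val_root : val r = setT.
Proof. exact/eqP/(xchooseP ball_root_exists). Qed.

Lemma proper_root B : B != r -> val B \proper val r.
Proof. by rewrite -val_eqE val_root properT. Qed.

(** Least cardinality gives the least ball for inclusion, because balls with a common point form a
    chain. No ball qualifies when [B] is the root, and the value is then the default [r]. *)
Definition parent B : ball_vertex :=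
  [arg min_(C < r | val B \proper val C) #|val C|].

Definition end_ball i : ball_vertex := [arg min_(C < r | i \in val C) #|val C|].

Lemma parent_proper B : B != r -> val B \proper val (parent B).
Proof. by move=> /proper_root Br; rewrite /parent; case: arg_minnP. Qed.

Lemma parent_min B C : val B \proper val C -> val (parent B) \subset val C.
Proof.
move=> BC; have Br : B != r.
  by apply: contraTneq BC => ->; rewrite val_root properE negb_and negbK subsetT orbT.
have := proper_root Br; rewrite /parent; case: arg_minnP; first exact: proper_root.
move=> D BD Dmin _; have [k [_ [_ kB _ _ _]]] := heightP B.
have kC := subsetP (proper_sub BC) _ kB; have kD := subsetP (proper_sub BD) _ kB.
have /orP[//|CD] := ball_linear kD kC.
by have := Dmin _ BC; move/(conj CD)/andP; rewrite -eqEcard => /eqP->.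
Qed.

Lemma end_ballP i : i \in val (end_ball i).
Proof. by rewrite /end_ball; case: arg_minnP; rewrite ?val_root ?inE. Qed.

Lemma end_ball_min i C : i \in val C -> val (end_ball i) \subset val C.
Proof.
move=> iC; rewrite /end_ball; case: arg_minnP; first by rewrite val_root inE.
move=> D iD Dmin; have /orP[//|CD] := ball_linear iD iC.
by have := Dmin _ iC; move/(conj CD)/andP; rewrite -eqEcard => /eqP->.
Qed.

Lemma parent_rank B : B != r -> (#|val B| < #|val (parent B)|)%N.
Proof. by move=> /parent_proper; exact: proper_card. Qed.

Local Notation rk := (fun B : ball_vertex => #|val B|).
Local Notation tree := (@par_graph _ r parent rk parent_rank).
Local Notation len := (par_len r parent height).
Local Notation is_child := (child r parent).

(** Children sharing a point are nested. If one were strictly inside the other, its parent [B] would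
    be contained in that sibling. *)
Lemma children_disjoint B C D k :
  is_child B C -> is_child B D -> k \in val C -> k \in val D -> C = D.
Proof.
move=> /andP[Cr /eqP CB] /andP[Dr /eqP DB] kC kD.
have CB' := parent_proper Cr; have DB' := parent_proper Dr.
have not_proper (E F : ball_vertex) : parent E = B -> val F \proper val B ->
    ~~ (val E \proper val F).
  move=> EB /andP[_ FB]; apply: contra FB => /parent_min.
  by rewrite EB.
apply/eqP; rewrite -val_eqE eqEsubset.
have /orP[] := ball_linear kC kD => sub; rewrite sub ?andbT /=.
  have := not_proper C D CB; rewrite -DB DB' properE sub /= negbK; exact.
have := not_proper D C DB; rewrite -CB CB' properE sub /= negbK; exact.
Qed.

(** The child is the largest ball around [i] strictly inside [B]; [end_ball i] is a candidate. *)
Lemma ball_child B i : i \in val B -> end_ball i != B ->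
  exists2 C, is_child B C & i \in val C.
Proof.
move=> iB eB.
pose P (C : ball_vertex) := (i \in val C) && (val C \proper val B).
have P0 : P (end_ball i).
  by rewrite /P end_ballP properEneq val_eqE eB end_ball_min.
case: (@arg_maxnP _ (end_ball i) P rk P0) => C /andP[iC CB] Cmax; exists C => //.
have Cr : C != r.
  by apply: contraTneq CB => ->; rewrite val_root properE negb_and negbK subsetT orbT.
rewrite /child /= Cr -val_eqE /=; apply: contraT => neq.
have /andP[pC _] := parent_proper Cr.
have : (#|val (parent C)| <= #|val C|)%N.
  apply: Cmax; rewrite /P (subsetP pC) //= properEneq neq.
  exact: parent_min.
by rewrite leqNgt parent_rank.
Qed.

Definition ball_end (k : 'I_m.+1) : ball_vertex :=
  if unlift ord0 k is Some i then end_ball i else r.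

Lemma ball_end_lift i : ball_end (lift ord0 i) = end_ball i.
Proof. by rewrite /ball_end liftK. Qed.

Lemma ball_end0 : ball_end ord0 = r.
Proof. by rewrite /ball_end unlift_none. Qed.

(** The paths part at the smallest ball containing [i] and [j]. If their last common vertex [B] were
    larger, the next vertices on both paths would contain that ball, hence share a point and be the
    same child of [B]. *)
Lemma height_lcp i j p q : i != j ->
  simple_path tree r (end_ball i) p -> simple_path tree r (end_ball j) q ->
  height (last r (lcp p q)) = lam i j.
Proof.
move=> ij pP qP; have [a [b [pE qE ab]]] := lcpP p q.
have := root_path_child pP; have := root_path_child qP.
case: pP qP => _ _ + [_ _ +]; move: (lcp p q) pE qE => c -> ->.
rewrite !last_cat !cat_path; move: (last r c) => B la lb /andP[_ bB] /andP[_ aB].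
have last_sub s D : path is_child D s -> val (last D s) \subset val D.
  elim: s D => //= C s IH D /andP[/andP[Cr /eqP<-]] /IH/subset_trans; apply.
  exact/proper_sub/parent_proper.
have iB : i \in val B by apply: (subsetP (last_sub _ _ aB)); rewrite la end_ballP.
have jB : j \in val B by apply: (subsetP (last_sub _ _ bB)); rewrite lb end_ballP.
rewrite -(height_ball ij); congr height; apply/eqP; rewrite -val_eqE eqEsubset ball_min //.
rewrite andbT; apply: contraT => JB.
have {}JB : val (ball ij) \proper val B by rewrite properE ball_min.
have sub_child C s k : k \in val (ball ij) -> last C s = end_ball k ->
    is_child B C -> path is_child C s -> val (ball ij) \subset val C.
  move=> kJ lk /andP[_ /eqP CB] /last_sub sC.
  have kC : k \in val C by apply: (subsetP sC); rewrite lk end_ballP.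
  have /orP[//|CJ] := ball_linear kJ kC.
  rewrite subEproper in CJ; case/predU1P: CJ => [->//|/parent_min].
  by rewrite CB => BJ; move: JB; rewrite properE BJ andbF.
(* A path stopping at [B] would make [B] the ball of its end, which lies inside [ball ij]. *)
case: a la aB ab => [lB|C a la /andP[BC aC] ab].
  by move: JB; rewrite properE -[B]/(last B [::]) lB end_ball_min ?ball_l // andbF.
case: b lb bB ab => [lB|D b lb /andP[BD bD] ab].
  by move: JB; rewrite properE -[B]/(last B [::]) lB end_ball_min ?ball_r // andbF.
have iC := subsetP (sub_child C a i (ball_l ij) la BC aC) _ (ball_l ij).
have iD := subsetP (sub_child D b j (ball_r ij) lb BD bD) _ (ball_l ij).
by move: ab; rewrite /= (children_disjoint BC BD iC iD) eqxx.
Qed.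

Lemma ball_gromov i j : i != j ->
  gromov tree len (ball_end ord0) (ball_end (lift ord0 i)) (ball_end (lift ord0 j)) =
  lam i j - height r.
Proof.
move=> ij; rewrite ball_end0 !ball_end_lift.
have [con acy] := par_tree parent_rank.
have [p pP] := simple_path_exists r (end_ball i) con.
have [q qP] := simple_path_exists r (end_ball j) con.
rewrite (gromov_lcp _ acy pP qP) -(height_lcp ij pP qP).
apply: (walk_length_child parent_rank height).
have /prefixP[s pE] := prefix_lcpl p q.
by have := root_path_child pP; rewrite {1}pE cat_path => /andP[].
Qed.

Lemma ball_len_gt0 e : e \in sedges tree -> 0 < len e.
Proof.
case/imsetP=> B Br ->; rewrite (par_lenE parent_rank height Br) subr_gt0.
exact/height_proper/parent_proper.
Qed.

(** If [i] and [j] span [B], three branches leave it: towards [i], towards [j], and towards the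
    root, the last being the root end when [B] is the root. The first two differ, since a child
    containing both [i] and [j] would contain [B]. *)
Lemma ball_valence B :
  (3 <= #|[set e in sedges tree | B \in e]| + #|[set k | ball_end k == B]|)%N.
Proof.
set X := [set e in _ | _]; set Y := [set k | _].
(* Edges and ends at [B] are gathered in a sum type, so that three distinct elements bound the
   valence. *)
pose incident (z : {set ball_vertex} + 'I_m.+1) :=
  match z with inl e => e \in X | inr k => k \in Y end.
have [i [j [ij iB jB hB BE]]] := heightP B.
have BJ C : i \in val C -> j \in val C -> val B \subset val C.
  move=> iC; rewrite (ballE iC) BE inE -hB => CB.
  by apply/subsetP=> k; rewrite !inE; exact: le_trans.
have XE C : C != r -> (B == C) || (B == parent C) -> [set C; parent C] \in X.
  move=> Cr BC; rewrite inE; apply/andP; split; last by rewrite !inE.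
  by apply/imsetP; exists C.
have branch k : k \in val B -> exists2 z, incident z &
    match z with
    | inl e => exists2 C, e = [set C; parent C] & is_child B C && (k \in val C)
    | inr l => l = lift ord0 k
    end.
  move=> kB; have [kE|kE] := eqVneq (end_ball k) B.
    by exists (inr (lift ord0 k)); rewrite //= inE ball_end_lift kE.
  have [C BC kC] := ball_child kB kE; exists (inl [set C; parent C]).
    by case/andP: BC => Cr /eqP CB; apply: XE; rewrite // CB eqxx orbT.
  by exists C; rewrite // BC.
have [zi zi_inc zi_br] := branch i iB; have [zj zj_inc zj_br] := branch j jB.
have child_not_B C D : is_child B C ->
    [set C; parent C] = [set D; parent D] -> D != r -> C = D.
  by case/andP=> Cr _ + Dr; exact: (par_edge_inj parent_rank).
have [z z_inc [zi_z zj_z]] : exists2 z, incident z & z != zi /\ z != zj.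
  have [Br|Br] := eqVneq B r.
    exists (inr ord0); first by rewrite /= inE ball_end0 Br.
    have neq0 k : inr ord0 != inr (lift ord0 k) :> {set ball_vertex} + 'I_m.+1.
      by apply: contraNneq (neq_lift ord0 k) => E; rewrite {1}(inr_inj E).
    by split; [case: (zi) zi_br|case: (zj) zj_br] => //= l ->.
  exists (inl [set B; parent B]); first by apply: XE; rewrite ?eqxx.
  suff up k z : match z with
    | inl e => exists2 C, e = [set C; parent C] & is_child B C && (k \in val C)
    | inr l => l = lift ord0 k
    end -> inl [set B; parent B] != z by split; [exact: up zi_br|exact: up zj_br].
  case: z => // e [C -> /andP[/andP[Cr /eqP CB] _]]; apply/eqP=> -[BC].
  have := par_edge_inj parent_rank Br Cr BC => E.
  by have := parent_proper Cr; rewrite CB E properxx.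
have zij : zi != zj.
  apply/eqP=> E; move: zi_br zj_br; rewrite {zi_inc z_inc zi_z zj_z}E.
  case: zj {zj_inc} => [e [C -> /andP[BC iC]] [D CD /andP[BD jD]]|l ->];
    last first.
    move=> /lift_inj E.
    by rewrite E eqxx in ij.
  have DC : D = C.
    by case/andP: BD => Dr _; apply/esym/(child_not_B _ _ BC CD).
  rewrite DC in jD; have := BJ _ iC jD.
  case/andP: BC => Cr /eqP CB; have := parent_proper Cr.
  by rewrite CB properE => /andP[_ /negP].
rewrite -(card_imset X (@inl_inj _ 'I_m.+1)) -(card_imset Y (@inr_inj {set ball_vertex} _)).
apply: leq_trans (leq_card_setU _ _).1; apply/card_gt2P.
have incP y : incident y -> y \in inl @: X :|: inr @: Y.
  by rewrite inE; case: y => y yX; rewrite imset_f ?orbT.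
by exists zi, zj, z; split; split; rewrite ?incP // eq_sym.
Qed.

Definition ball_comb : comb_type 'I_m.+1 :=
  CombType (par_tree parent_rank) ball_valence.

(** The weak ordering is read off from the distances, so [ball_rad_metric] holds by construction. *)
Definition ball_rad_type : rad_type m :=
  @RadType m ball_comb (fun B C =>
    tree_dist tree len r B <= tree_dist tree len r C).

Lemma ball_rad_metric : @rad_metric R m ball_rad_type len.
Proof.
split=> [e|d0 B C]; first exact: ball_len_gt0.
by rewrite /d0 /= ball_end0.
Qed.

End BallTree.

(** The constant is the height of the root ball, where all paths start; it disappears modulo the
    lineality space. *)
Lemma ultrametric_realization (R : realType) (m : nat) (lam : 'I_m -> 'I_m -> R) :
  (1 < m)%N -> (forall i j, lam i j = lam j i) ->
  (forall i j k, Num.min (lam i j) (lam j k) <= lam i k) ->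
  exists (t : rad_type m) (len : {set ct_vertex t} -> R) (c : R),
    @rad_metric R m t len /\
    forall i j, i != j ->
      gromov (ct_graph t) len (ct_end t ord0) (ct_end t (lift ord0 i))
        (ct_end t (lift ord0 j)) = lam i j - c.
Proof.
move=> m1 lamC lam_ultra.
have i01 : Ordinal (ltnW m1) != Ordinal m1 by [].
pose r := ball_root lamC lam_ultra i01.
exists (ball_rad_type lamC lam_ultra i01).
exists (par_len r (parent lamC lam_ultra i01) (@height _ _ lam)), (height r).
split; first exact: ball_rad_metric.
exact: ball_gromov.
Qed.

(** * Projection of the moduli space *)

Section Assembly.
Variables (R : realType) (m : nat).

Lemma psi_gromov (t : rad_type m) (len : {set ct_vertex t} -> R)
    (x : edgespace R (complete 'I_m.+1)) :
  (forall i j (ij : i != j), x (kedge ij) =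
     tree_dist (ct_graph t) len (ct_end t i) (ct_end t j)) ->
  forall i j (ij : i != j), psi x (kedge ij) =
    - gromov (ct_graph t) len (ct_end t ord0)
        (ct_end t (lift ord0 i)) (ct_end t (lift ord0 j)).
Proof.
move=> xE i j ij; rewrite ffunE /= big_setU1 ?inE //= big_set1.
have lij : lift ord0 i != lift ord0 j by rewrite (inj_eq (@lift_inj _ _)).
have -> : lift_edge (kedge ij) = kedge lij.
  by apply: val_inj; rewrite /= imsetU !imset_set1.
by rewrite !xE /gromov -mulNr opprB.
Qed.

(** Either order of the endpoints may be picked from an edge; symmetry of the distance makes the
    choice harmless. *)
Lemma dist_vector_exists (t : rad_type m) (len : {set ct_vertex t} -> R) :
  exists x : edgespace R (complete 'I_m.+1), forall i j (ij : i != j), x (kedge ij) =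
     tree_dist (ct_graph t) len (ct_end t i) (ct_end t j).
Proof.
pose d i j := tree_dist (ct_graph t) len (ct_end t i) (ct_end t j).
exists [ffun e : edge (complete 'I_m.+1) =>
  if [pick p : 'I_m.+1 * 'I_m.+1 | val e == [set p.1; p.2]] is Some p
  then d p.1 p.2 else 0 : R^o].
move=> i j ij; rewrite ffunE; case: pickP => [[k l] /= /eqP|/(_ (i, j))]; last first.
  by rewrite /= eqxx.
by case/set2_eq=> -[-> ->] //; apply/tree_distC/ct_tree.
Qed.

Variable G : sgraph 'I_m.

Lemma flat_level_psi (t : rad_type m) (len : {set ct_vertex t} -> R)
    (x : edgespace R (complete 'I_m.+1)) (a : R) :
  @rad_metric R m t len ->
  (forall i j (ij : i != j), x (kedge ij) =
     tree_dist (ct_graph t) len (ct_end t i) (ct_end t j)) ->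
  flat G (level (restrict G (psi x)) a).
Proof.
move=> [len_gt0 _] xE; have trG := ct_tree t.
pose g (i j : 'I_m) := gromov (ct_graph t) len (ct_end t ord0)
  (ct_end t (lift ord0 i)) (ct_end t (lift ord0 j)).
have g_trans i j k : - a <= g i j -> - a <= g j k -> - a <= g i k.
  move=> ij jk; have len_ge0 e : e \in sedges (ct_graph t) -> 0 <= len e.
    by move=> /len_gt0/ltW.
  apply: le_trans (gromov_ultrametric _ _ (ct_end t (lift ord0 j)) _ trG len_ge0).
  by rewrite le_min; apply/andP.
have levelE i j (ijG : [set i; j] \in sedges G) :
    ([set i; j] \in level (restrict G (psi x)) a) = (- a <= g i j).
  pose e : edge G := exist (fun e => e \in sedges G) _ ijG.
  rewrite -[[set i; j]]/(val e) in_level ffunE (_ : edge_complete _ = kedge (sgraph_edge_neq ijG));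
    last exact: val_inj.
  by rewrite (psi_gromov xE) lerNl.
apply/flatP; split=> [|u v uvG]; first exact: level_sub.
rewrite levelE // => /connectP[p pP vE].
(* The alternative [u = v] serves the empty path, which gives no bound on [g u u]. *)
suff [uv|//]: u = v \/ - a <= g u v.
  by have := sgraph_edge_neq uvG; rewrite uv eqxx.
rewrite {}vE {uvG}; elim: p u pP => [|w p IH] u /=; first by left.
case/andP=> /andP[_ uwF] /IH pP; right.
have uw : - a <= g u w by rewrite -levelE // (subsetP (level_sub _ _) _ uwF).
by case: pP => [<-//|]; exact: g_trans.
Qed.

(** * The ultrametric similarity of a weighted flag *)

Section FlagUltrametric.
Variables (Fs : seq {set {set 'I_m}}) (c : {set {set 'I_m}} -> R).
Hypothesis FsP : flag G Fs.
Hypothesis c_ge0 : forall F, 0 <= c F.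

(** Connectivity in place of membership extends the weights to all pairs, including non-edges of
    [G]; on edges the two agree because the [F] are flats. *)
Definition flag_lam i j : R := \sum_(F <- Fs | connect (adj F) i j) c F.

Lemma flag_lamC i j : flag_lam i j = flag_lam j i.
Proof. by apply: eq_bigl => F; rewrite adj_connect_sym. Qed.

Lemma flag_total F F' : F \in Fs -> F' \in Fs -> (F \subset F') || (F' \subset F).
Proof.
case: FsP => sFs _ /(nthP set0)[i iFs <-] /(nthP set0)[j jFs <-].
have sub_tr : transitive (fun F F' : {set {set 'I_m}} => F \subset F').
  by move=> ? ? ?; exact: subset_trans.
have {}sFs : sorted (fun F F' : {set {set 'I_m}} => F \subset F') Fs.
  by apply: sub_sorted sFs => ? ?; exact: proper_sub.
have mono := sorted_leq_nth sub_tr (fun F => subxx F) set0 sFs.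
by apply/orP; case: (leqP i j) => [ij|/ltnW ji]; [left|right]; apply: mono.
Qed.

(** Either every flat connecting [i] and [j] connects [j] and [k], or some [F0] connects only the
    first pair. In the latter case every flat connecting [j] and [k] contains [F0], by the chain
    condition, and so connects [i] and [j] too. *)
Lemma flag_lam_ultra i j k : Num.min (flag_lam i j) (flag_lam j k) <= flag_lam i k.
Proof.
have le_lam a b d e : {in Fs, forall F, connect (adj F) a b -> connect (adj F) d e} ->
    flag_lam a b <= flag_lam d e.
  move=> ab_de; rewrite /flag_lam big_mkcond [leRHS]big_mkcond big_seq [leRHS]big_seq.
  apply: ler_sum => F /ab_de; case: (connect _ a b) => [->//|_].
  by case: ifP.
rewrite ge_min.
have [/allP ijk|] := boolP (all (fun F => connect (adj F) i j ==> connect (adj F) j k) Fs).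
  apply/orP; left; apply: le_lam => F /ijk/implyP jk ij.
  exact: connect_trans ij (jk ij).
case/allPn=> F0 F0s; rewrite negb_imply => /andP[ij njk].
apply/orP; right; apply: le_lam => F FFs jk.
apply: (connect_trans _ jk); case/orP: (flag_total F0s FFs) => sub.
  exact: sub_adj sub _ _ ij.
by case/negP: njk; exact: sub_adj sub _ _ jk.
Qed.

Lemma flag_lamE i j : [set i; j] \in sedges G ->
  flag_lam i j = \sum_(F <- Fs | [set i; j] \in F) c F.
Proof.
move=> ijG; rewrite /flag_lam big_seq_cond [RHS]big_seq_cond; apply: eq_bigl => F.
case: (boolP (F \in Fs)) => //= FFs; case: FsP => _ /(_ _ FFs)[/flatP[_ flatF] _ _].
apply/idP/idP; first exact: flatF.
by move=> ijF; apply: connect1; rewrite /adj /= (sgraph_edge_neq ijG).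
Qed.

End FlagUltrametric.

End Assembly.

Theorem theorem3p21 (R : realType) (n : nat) (hn : (4 <= n)%N)
    (G : sgraph 'I_n.-1) (hG : graph_connected G) :
  (pi_target R G @` (pi_graph R G @` (Psi R n.-1 @` Mrad R n.-1)))%classic
  = Bprime R G.
Proof.
apply/seteqP; split=> [_ [_ [_ [_ [t [len lenP [x xE ->]]] <-] <-] <-]|z].
  by rewrite PsiE pi_targetE; apply: Bprime_level => a; exact: flat_level_psi lenP xE.
case=> Fs FsP [c c_ge0 ->]; rewrite rho_sum.
have m1 : (1 < n.-1)%N by case: (n) hn => [|[|[|]]].
have [t [len [h [lenP gE]]]] := ultrametric_realization m1
  (flag_lamC Fs c) (flag_lam_ultra FsP c_ge0).
have [x xE] := dist_vector_exists len.
exists (pi_graph R G (Psi R n.-1 (qclass _ x))).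
  exists (Psi R n.-1 (qclass _ x)) => //; exists (qclass _ x) => //.
  by exists t, len => //; exists x.
(* The realized curve has Gromov products [flag_lam - h], so its image differs from the given point
   by the constant [h]. *)
rewrite PsiE pi_targetE; apply: (@qclass_shift _ _ _ _ _ h) => e.
have [i [j [ij eE]]] := sgraph_edge (valP e).
have ijG : [set i; j] \in sedges G by rewrite -eE; exact: valP e.
rewrite [LHS]ffunE (_ : edge_complete e = kedge ij); last exact: val_inj.
by rewrite [in RHS]ffunE (psi_gromov xE) gE // opprB addrC (flag_lamE c FsP ijG) -eE.
Qed.
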